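(* Let $q$ and $r$ be positive integers. There is a constant $c=c(q,r)$ such that every connected, quasi-bridgeless, $S_{1,1,q,r}$-subgraph-free graph that is not subcubic has treedepth at most $c$.
   Context: For positive integers $w,x,y,z$, $S_{w,x,y,z}$ is the tree obtained from the star $K_{1,4}$ by subdividing its four edges $w-1$, $x-1$, $y-1$ and $z-1$ times respectively (four paths of lengths $w,x,y,z$ sharing a common endvertex). A graph $G$ is $H$-subgraph-free if $H$ is not isomorphic to any subgraph of $G$. A graph is subcubic if every vertex has degree at most $3$. A bridge is an edge whose removal increases the number of connected components; a bridge is proper if neither of its endvertices has degree $1$; a graph is quasi-bridgeless if it has no proper bridge. The treedepth of $G$ is the minimum height of a rooted forest $F$ on vertex set $V(G)$ such that for every edge $uv$ of $G$, one of $u,v$ is an ancestor of the other in $F$. *)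

(* Defs.v *)
From mathcomp Require Import all_boot.
Set Implicit Arguments. Unset Strict Implicit. Unset Printing Implicit Defensive.

Definition simple_graph (T : finType) (e : rel T) : Prop :=
  symmetric e /\ irreflexive e.

Definition contains_subgraph (TH : finType) (eH : rel TH)
    (TG : finType) (eG : rel TG) : Prop :=
  exists f : TH -> TG, injective f /\ forall u v, eH u v -> eG (f u) (f v).

Definition subgraph_free (TH : finType) (eH : rel TH)
    (TG : finType) (eG : rel TG) : Prop := ~ contains_subgraph eH eG.

(* The spider S_{w,x,y,z}: a center (None) and four legs; leg i has vertices
   (i,0),...,(i,len i - 1), with (i,0) adjacent to the center and (i,j)
   adjacent to (i,j+1).  Leg i is a path of length len i. *)
Section Spider.
Variables w x y z : nat.
Definition sp_len (i : 'I_4) : nat := nth 0 [:: w; x; y; z] i.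
Definition sp_N := (w + x + y + z).+1.
Definition sp_valid (o : option ('I_4 * 'I_sp_N)) : bool :=
  if o is Some (i, j) then (nat_of_ord j < sp_len i) else true.
Definition spider_vertex := {o : option ('I_4 * 'I_sp_N) | sp_valid o}.
Definition sp_adj0 (a b : option ('I_4 * 'I_sp_N)) : bool :=
  match a, b with
  | None, Some (_, j) => nat_of_ord j == 0
  | Some (i, j), Some (i', j') => (i == i') && ((nat_of_ord j).+1 == j')
  | _, _ => false
  end.
Definition spider_edge : rel spider_vertex :=
  fun u v => sp_adj0 (val u) (val v) || sp_adj0 (val v) (val u).
End Spider.

Definition connected_graph (T : finType) (e : rel T) : Prop :=
  forall u v : T, connect e u v.

Definition degree (T : finType) (e : rel T) (v : T) : nat := #|[set u | e v u]|.

Definition subcubic (T : finType) (e : rel T) : Prop :=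
  forall v : T, degree e v <= 3.

Definition ncomp (T : finType) (e : rel T) : nat := n_comp e predT.

Definition remove_edge (T : finType) (e : rel T) (u v : T) : rel T :=
  fun a b => e a b && ~~ (((a == u) && (b == v)) || ((a == v) && (b == u))).

Definition bridge (T : finType) (e : rel T) (u v : T) : Prop :=
  e u v /\ ncomp e < ncomp (remove_edge e u v).

Definition proper_bridge (T : finType) (e : rel T) (u v : T) : Prop :=
  bridge e u v /\ degree e u != 1 /\ degree e v != 1.

Definition quasi_bridgeless (T : finType) (e : rel T) : Prop :=
  forall u v : T, ~ proper_bridge e u v.

(* Rooted forests on T given by a parent function par : T -> option T
   (None = root).  up^k (Some v) is the k-th ancestor of v (k = 0: v itself). *)
Definition anc_iter (T : finType) (par : T -> option T) (k : nat) (v : T) : option T :=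
  iter k (fun o => obind par o) (Some v).

(* the forest has height at most h: every root-to-vertex path has at most h
   vertices (this also forces acyclicity, i.e. par defines a forest) *)
Definition forest_height_le (T : finType) (par : T -> option T) (h : nat) : Prop :=
  forall v : T, anc_iter par h v = None.

Definition is_ancestor (T : finType) (par : T -> option T) (a v : T) : Prop :=
  exists k, anc_iter par k v = Some a.

Definition treedepth_le (T : finType) (e : rel T) (c : nat) : Prop :=
  exists par : T -> option T,
    forest_height_le par c /\
    forall u v : T, e u v -> is_ancestor par u v \/ is_ancestor par v u.

(* Main.v *)
Require Import Defs.
From mathcomp Require Import all_boot zify.
Set Implicit Arguments. Unset Strict Implicit. Unset Printing Implicit Defensive.

(** Put m = max(q, r) and let v have degree at least 4.  A depth-first search
    from v bounds the treedepth by the number of vertices of a longest path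
    starting at v, so assume that P is a very long path p_0 p_1 ... from v.

    A vertex of degree at least 4 that starts two disjoint paths of length more
    than 4m is the center of an S_{1,1,m,m}: if one of its other neighbours lies
    on a leg, the leg can be entered there, which frees its first vertex.
    Hence, after deleting a short initial part of P, the vertex p_0 has degree
    at least 4 while p_1, ..., p_M have degree at most 3.  As no edge of P is a
    proper bridge, each p_i with 0 < i <= M is then bypassed by a path
    that leaves P before p_i, avoids P, and returns after p_i.

    Put x_0 = 1 and let x_(k+1) be the farthest index of P reached by such a
    detour starting before x_k.  By maximality these detours are pairwise
    disjoint, so together with segments of P they form two disjoint paths from
    p_0 to p_(x_k) and p_(x_(k+1)).  If some x_(k+1) - x_k is large, then
    closing up along P yields a long cycle through p_0; otherwise k gets large,
    which again makes the cycle long.  A long cycle through p_0 provides the two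
    long legs of a spider centered at p_0. *)

(** * Depth-first search forests and treedepth *)

(** Induction on [n]: isolate [v], recurse in each remaining component from a neighbour of [v], and
    hang the resulting trees below [v]. Prepending [v] to a path of the smaller graph lengthens it
    by one, so the bound on paths drops along with [n]. An edge avoiding [v] stays inside one
    component, hence inside one tree. *)
Lemma dfs_forest (T : finType) (n : nat) (e : rel T) (v : T) :
  symmetric e ->
  (forall p, path e v p -> uniq (v :: p) -> size p < n) ->
  exists par : T -> option T,
    [/\ par v = None,
        forall u w, connect e v u -> par u = Some w -> connect e v w,
        forall u, connect e v u -> exists2 k, k < n & anc_iter par k u = Some v
      & forall u w, connect e v u -> e u w ->
          is_ancestor par u w \/ is_ancestor par w u].
Proof.
elim: n e v => [|n IHn] e v esym short; first by have := short [::] isT isT.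
pose e' := [rel a b | [&& e a b, a != v & b != v]].
have e'sym : symmetric e'.
  by move=> a b; rewrite /= esym; congr (_ && _); rewrite andbC.
have e'sub : subrel (connect e') (connect e).
  by apply: connect_sub => a b /and3P[eab _ _]; apply: connect1.
have e'neq a b : connect e' a b -> a != v -> b != v.
  case/connectP => p; elim: p a => [|c p IHp] a /= => [_ -> //|].
  by case/andP => /and3P[_ _ cv] pth lst _; apply: (IHp c).
have csym : connect_sym e' by apply: sym_connect_sym.
(* The condition on [r] sits under the existential so that [fin_all_exists] can choose a forest for
   every [r] at once. *)
have ex_par r : exists par : T -> option T, e v r && (r != v) ->
    [/\ par r = None,
        forall u w, connect e' r u -> par u = Some w -> connect e' r w,
        forall u, connect e' r u -> exists2 k, k < n & anc_iter par k u = Some r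
      & forall u w, connect e' r u -> e' u w ->
          is_ancestor par u w \/ is_ancestor par w u].
  case: (boolP (e v r && (r != v))) => [/andP[evr rv]|_]; last by exists (fun=> None).
  have [|par Hpar] := IHn e' r e'sym; last by exists par.
  move=> p pth un; have := short (r :: p); apply.
    by rewrite /= evr; apply: sub_path pth => a b /and3P[].
  rewrite cons_uniq un andbT; apply/negP => vin.
  by have := e'neq _ _ (path_connect pth vin) rv; rewrite eqxx.
have {ex_par} [parf parfP] := fin_all_exists ex_par.
(* The chosen neighbour of [v] in the component of [u] without [v]. It is selected through
   [root e' u], so all vertices of a component get the same one. *)
pose rt u := odflt v [pick r | [&& e v r, r != v & connect e' (root e' u) r]].
have rtE u w : connect e' u w -> rt u = rt w.
  by move=> cuw; rewrite /rt (rootP csym cuw).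
have rtP u : connect e v u -> u != v ->
    [/\ e v (rt u), rt u != v & connect e' (rt u) u].
  case/connectP => p pth ->; case: (shortenP pth) => {pth} [[|r p'] /=]; first by rewrite eqxx.
  case/andP => evr pth /andP[vp _] _ _.
  have c' : connect e' r (last r p').
    apply/connectP; exists p' => //; move: vp pth {evr}; elim: p' r => //= c p' IHp r.
    rewrite inE !negb_or => /and3P[vr vc vp'] /andP[-> pth].
    by rewrite eq_sym vr eq_sym vc /=; apply: IHp; rewrite // inE negb_or vc.
  rewrite /rt; case: pickP => [r' /and3P[-> ->]|/(_ r)] /=.
    by rewrite csym => c2; split=> //; apply: connect_trans c2 _; rewrite csym connect_root.
  rewrite evr /= csym (connect_trans c') ?connect_root // andbT.
  by move=> /negbFE /eqP rv; rewrite rv inE eqxx in vp.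
pose par u := if u == v then None else if u == rt u then Some v else parf (rt u) u.
(* Inside a component the combined forest follows the recursive one, so ancestors there remain
   ancestors. *)
have chain u : connect e v u -> u != v -> forall k w,
    anc_iter (parf (rt u)) k u = Some w ->
    anc_iter par k u = Some w /\ connect e' (rt u) w.
  move=> cu uv; have [evr rv cr] := rtP _ cu uv.
  have [pr closed _ _] := parfP (rt u) (introT andP (conj evr rv)).
  elim=> [|k IHk] w; first by case=> <-.
  rewrite /anc_iter !iterS -!/(anc_iter _ _ _).
  case E: (anc_iter _ k u) => [x|] //= px; have [-> cx] := IHk _ E.
  split; last exact: closed px.
  have rx : rt x = rt u by apply: rtE; rewrite csym in cx; apply: connect_trans cx cr.
  rewrite /= /par (negbTE (e'neq _ _ cx rv)) rx.
  by case: eqP => // xr; rewrite xr pr in px.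
have toroot u : connect e v u -> exists2 k, k < n.+1 & anc_iter par k u = Some v.
  move=> cu; have [->|uv] := eqVneq u v; first by exists 0.
  have [evr rv cr] := rtP _ cu uv.
  have [_ _ Hk _] := parfP (rt u) (introT andP (conj evr rv)).
  have [k kn ak] := Hk _ cr; have [ak' _] := chain _ cu uv _ _ ak.
  exists k.+1 => //; rewrite /anc_iter iterS -/(anc_iter _ _ _) ak' /= /par (negbTE rv).
  by rewrite (rtE _ _ cr) eqxx.
exists par; split=> //.
- by rewrite /par eqxx.
- move=> u w cu; rewrite /par; case: eqVneq => // uv; have [evr rv cr] := rtP _ cu uv.
  have [_ closed _ _] := parfP (rt u) (introT andP (conj evr rv)).
  case: eqP => [_ [<-] //|_ pw].
  by apply: connect_trans (connect1 evr) (e'sub _ _ (closed _ _ cr pw)).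
move=> u w cu euw; have cw : connect e v w := connect_trans cu (connect1 euw).
have [uv|uv] := eqVneq u v.
  by left; have [k _ ak] := toroot _ cw; exists k; rewrite uv.
have [wv|wv] := eqVneq w v.
  by right; have [k _ ak] := toroot _ cu; exists k; rewrite wv.
have [evr rv cr] := rtP _ cu uv.
have [_ _ _ anc] := parfP (rt u) (introT andP (conj evr rv)).
have e'uw : e' u w by rewrite /= euw uv.
have ruw := rtE _ _ (@connect1 _ e' _ _ e'uw).
case: (anc _ _ cr e'uw) => -[k ak]; [left|right]; exists k.
  by rewrite ruw in ak; have [] := chain _ cw wv _ _ ak.
by have [] := chain _ cu uv _ _ ak.
Qed.

Lemma treedepth_le_of_short_paths (T : finType) (e : rel T) (v : T) (n : nat) :
  symmetric e -> connected_graph e ->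
  (forall p, path e v p -> uniq (v :: p) -> size p < n) -> treedepth_le e n.
Proof.
move=> esym conn short; have [par [pv _ toroot anc]] := dfs_forest esym short.
exists par; split=> [u|u w euw]; last exact: anc (conn v u) euw.
have [k kn ak] := toroot u (conn v u).
(* One step above the root [v] yields [None], which all further iterations preserve. *)
have -> : n = (n - k.+1) + k.+1 by lia.
rewrite /anc_iter iterD iterS -/(anc_iter _ _ _) ak /= pv.
by elim: (n - _) => // j /= ->.
Qed.

(** * Spiders from disjoint paths and from long cycles *)

Lemma spider_of_legs (T : finType) (e : rel T) (q r : nat) (v x y : T) (A B : seq T) :
  symmetric e -> e v x -> e v y -> path e v A -> path e v B ->
  uniq [:: v, x, y & A ++ B] -> q <= size A -> r <= size B ->
  contains_subgraph (@spider_edge 1 1 q r) e.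
Proof.
move=> esym evx evy pA pB un qA rB.
pose leg (i : 'I_4) := nth [::] [:: [:: x]; [:: y]; A; B] i.
pose f (u : spider_vertex 1 1 q r) :=
  if val u is Some (i, j) then nth v (leg i) j else v.
have legsize i : sp_len 1 1 q r i <= size (leg i) by case: i => [[|[|[|[|?]]]] ?].
have legpath i : path e v (leg i) by case: i => [[|[|[|[|?]]]] ?] //=; rewrite ?evx ?evy.
have legv i : v \notin leg i.
  move: un; rewrite cons_uniq !inE !negb_or mem_cat negb_or => /andP[/and4P[vx vy vA vB] _].
  by case: i => [[|[|[|[|?]]]] ?] //=; rewrite /leg /= ?inE.
have legu i : uniq (leg i).
  move: un => /= /and4P[_ _ _]; rewrite cat_uniq => /and3P[uA _ uB].
  by case: i => [[|[|[|[|?]]]] ?].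
have legdis i i' z : z \in leg i -> z \in leg i' -> i = i'.
  move=> zi zi'; apply: val_inj; move: un.
  rewrite /= cat_uniq !inE !negb_or !mem_cat !negb_or.
  case/and4P=> _ /and3P[xy xA xB] /andP[yA yB] /and3P[_ /hasPn dis _].
  (* The pairwise disjointness of the four legs is tabulated as Boolean equations, which settle all
     cases [i != i'] by rewriting. *)
  have Exy : (z == x) && (z == y) = false.
    by apply: contraNF xy => /andP[/eqP<- /eqP<-].
  have ExA : (z == x) && (z \in A) = false by apply: contraNF xA => /andP[/eqP<-].
  have ExB : (z == x) && (z \in B) = false by apply: contraNF xB => /andP[/eqP<-].
  have EyA : (z == y) && (z \in A) = false by apply: contraNF yA => /andP[/eqP<-].
  have EyB : (z == y) && (z \in B) = false by apply: contraNF yB => /andP[/eqP<-].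
  have EAB : (z \in A) && (z \in B) = false.
    by apply/negbTE/negP => /andP[zA /dis /=]; rewrite zA.
  case: i i' zi zi' => [[|[|[|[|?]]]] ?] // [[|[|[|[|?]]]] ?] //=;
    rewrite /leg /= ?inE => zi zi'; move: Exy ExA ExB EyA EyB EAB;
    by rewrite zi zi'.
have flt (i : 'I_4) (j : nat) : j < sp_len 1 1 q r i -> j < size (leg i).
  by move=> ji; apply: leq_trans ji (legsize i).
exists f; split.
  move=> [[[i j]|] Hu] [[[i' j']|] Hw]; rewrite /f /= in Hu Hw * => E; apply: val_inj => //=.
  - have Ei : i = i'.
      by apply: (legdis _ _ (nth v (leg i) j)); [|rewrite E]; apply/mem_nth/flt.
    subst i'; congr (Some (_, _)); apply: val_inj; apply/eqP.
    by rewrite /= -(nth_uniq v (flt _ _ Hu) (flt _ _ Hw) (legu i)) E.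
  - by have := legv i; rewrite -E mem_nth // flt.
  - by have := legv i'; rewrite E mem_nth // flt.
have adj u w : sp_adj0 (val u) (val w) -> e (f u) (f w).
  case: u w => [[[i j]|] Hu] [[[i' j']|] Hw] //=; rewrite /f /= in Hu Hw *.
    case/andP => /eqP Ei /eqP Ej; subst i'.
    have /(pathP v) := legpath i; rewrite -Ej => /(_ j.+1) /=; apply.
    by apply: flt; rewrite Ej.
  by move/eqP=> j0; have /(pathP v) /(_ 0) := legpath i'; rewrite j0; apply; rewrite -j0 flt.
by move=> u w /orP[]/adj //; rewrite esym.
Qed.

(** Greedy search: if the window of [m] entries beginning at [x] contains a second mark, restart at
    that mark. This uses up one mark and at most [m.-1] entries. *)
Lemma isolated_mark_window (T : eqType) (N : pred T) (m n : nat) (x : T) (A : seq T) :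
  N x -> count N A <= n -> n.+1 * m <= (size A).+1 -> 0 < m ->
  exists A1 y A2,
    [/\ x :: A = A1 ++ y :: A2, N y, m <= (size A2).+1 & ~~ has N (take m.-1 A2)].
Proof.
move=> + + + m0; elim: n x A => [|n IHn] x A Nx cnt sz.
  exists [::], x, A; split=> //=; first lia.
  by apply: contraTN cnt => /hasP[z /mem_take zA Nz]; rewrite -ltnNge -has_count; apply/hasP; exists z.
case: (boolP (has N (take m.-1 A))) => [hN|hN]; last first.
  exists [::], x, A; split=> //=; rewrite mulSn in sz; lia.
have := hN; rewrite has_find => lt1.
have lt2 : find N (take m.-1 A) < m.-1 by apply: leq_trans lt1 _; rewrite size_take_min geq_minl.
have := nth_find x hN; rewrite nth_take //; set i := find _ _ in lt1 lt2 *; move=> Ni.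
have iA : i < size A by apply: leq_trans lt1 _; rewrite size_take_min geq_minr.
have EA : A = take i A ++ nth x A i :: drop i.+1 A by rewrite -drop_nth // cat_take_drop.
have [|||A1 [y [A2 [E Ny s h]]]] := IHn (nth x A i) (drop i.+1 A) => //.
- by move: cnt; rewrite {1}EA count_cat /= Ni; lia.
- by rewrite size_drop; rewrite mulSn in sz; lia.
by exists (x :: take i A ++ A1), y, A2; split=> //=; rewrite -catA -E -EA.
Qed.

(** Fix four neighbours of [v], among them the first vertices of [A] and [B]. Each path contains [m]
    consecutive vertices beginning with one of the four and containing no other; these are the long
    legs, and the two neighbours left over are the short ones. *)
Lemma spider_of_disjoint_paths (T : finType) (e : rel T) (q r m : nat) (v : T) (A B : seq T) :
  symmetric e -> irreflexive e -> 0 < m -> q <= m -> r <= m ->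
  path e v A -> path e v B -> uniq (v :: A ++ B) ->
  4 * m < size A -> 4 * m < size B -> 3 < degree e v ->
  contains_subgraph (@spider_edge 1 1 q r) e.
Proof.
move=> esym eirr m0 qm rm pA pB un szA szB deg.
case: A pA un szA => [|a A] pA un szA; first by rewrite ltn0 in szA.
case: B pB un szB => [|b B] pB un szB; first by rewrite ltn0 in szB.
have eva : e v a by case/andP: pA.
have evb : e v b by case/andP: pB.
have ab : a != b.
  by move: un; rewrite /= => /and3P[_]; rewrite mem_cat !inE !negb_or => /andP[_ /andP[]].
pose S := [set u | e v u] :\: [set a; b].
have : 1 < #|S|.
  rewrite /S cardsD; have := subset_leq_card (subsetIr [set u | e v u] [set a; b]).
  by rewrite cards2 ab /=; move: deg; rewrite /degree; lia.
case/card_gt1P => x [y []]; rewrite !inE !negb_or => /andP[/andP[xa xb] evx] /andP[/andP[ya yb] evy] xy.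
pose N4 := [:: a; b; x; y].
have uN : uniq N4.
  by rewrite /= !inE !negb_or ab xy (eq_sym a x) (eq_sym a y) (eq_sym b x) (eq_sym b y) xa xb ya yb.
have evN z : z \in N4 -> e v z by rewrite !inE => /or4P[]/eqP->.
pose N := [pred z | z \in N4].
have cN s : uniq s -> count N s <= 4.
  move=> us; rewrite -size_filter; apply: (@uniq_leq_size _ _ N4); first exact: filter_uniq.
  by move=> z; rewrite mem_filter => /andP[].
have [vAB uA uB disAB] : [/\ v \notin (a :: A) ++ b :: B, uniq (a :: A), uniq (b :: B) &
   forall z, z \in a :: A -> z \in b :: B -> False].
  move: un; rewrite cons_uniq cat_uniq => /andP[-> /and3P[-> /hasPn h ->]]; split=> // z zA /h /=.
  by rewrite zA.
have suffix c C : path e v (c :: C) -> uniq (c :: C) -> c \in N4 -> 4 * m < size (c :: C) ->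
    exists z C', [/\ z \in N4, path e v (z :: C'), m = size (z :: C'), uniq (z :: C')
      & {subset z :: C' <= c :: C} /\ ~~ has N C'].
  move=> pC uC cN4 sz.
  (* The first vertex [c] is itself a mark, so at most 3 marks follow; this is why length [4 * m]
     suffices. *)
  have [|||C1 [z [C2 [E Nz s h]]]] := @isolated_mark_window _ N m 3 c C cN4.
  - by have := cN _ uC; rewrite /= cN4.
  - exact: ltnW.
  - by [].
  exists z, (take m.-1 C2); split=> //.
  - have : path e v (C1 ++ z :: C2) by rewrite -E.
    by rewrite cat_path /= (evN _ Nz) => /and3P[_ _ pC2]; rewrite take_path.
  - by rewrite /= size_takel ?prednK // -ltnS prednK.
  - have : uniq (C1 ++ z :: C2) by rewrite -E.
    rewrite cat_uniq => /and3P[_ _ /= /andP[zC2 uC2]].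
    by rewrite take_uniq // andbT; apply: contra zC2 => /mem_take.
  - split=> // t; rewrite E mem_cat !inE => /orP[/eqP->|/mem_take ->]; by rewrite ?eqxx ?orbT.
have [||||z1 [C1 [Nz1 p1 s1 u1 [sub1 h1]]]] := suffix a A => //; first by rewrite inE eqxx.
have [||||z2 [C2 [Nz2 p2 s2 u2 [sub2 h2]]]] := suffix b B => //; first by rewrite !inE eqxx orbT.
have z12 : z1 != z2.
  by apply/eqP => E; apply: (disAB z1); [apply: sub1|rewrite E; apply: sub2]; rewrite inE eqxx.
(* The two neighbours that start no window; as the windows contain no further marks, these two lie
   on neither long leg. *)
pose R := [seq z <- N4 | (z != z1) && (z != z2)].
have szR : size R = 2.
  rewrite size_filter -(addnK (count (predC (fun z => (z != z1) && (z != z2))) N4) (count _ _)).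
  rewrite count_predC.
  have -> : count (predC (fun z => (z != z1) && (z != z2))) N4 = 2; last by [].
  rewrite (@eq_count _ _ (predU (pred1 z1) (pred1 z2))).
    have := count_predUI (pred1 z1) (pred1 z2) N4.
    rewrite !count_uniq_mem // Nz1 Nz2 => E.
    rewrite (@eq_count _ (predI _ _) pred0) ?count_pred0 ?addn0 in E => //.
    by move=> z; apply/negbTE; apply: contra z12 => /andP[/eqP<- /eqP->].
  by move=> z /=; rewrite negb_and !negbK.
have RP z : z \in R -> [/\ e v z, z != v, z \notin z1 :: C1 & z \notin z2 :: C2].
  rewrite mem_filter => /andP[/andP[zz1 zz2] zN]; have evz := evN _ zN; split=> //.
  - by apply/eqP => E; rewrite E eirr in evz.
  - by rewrite inE (negbTE zz1) /=; apply: contra h1 => zC; apply/hasP; exists z.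
  - by rewrite inE (negbTE zz2) /=; apply: contra h2 => zC; apply/hasP; exists z.
have uR : uniq R by apply: filter_uniq.
case: R szR RP uR => [|t1 [|t2 [|? ?]]] //= _ RP /andP[]; rewrite inE => t12 _.
have [et1 t1v t1C1 t1C2] : [/\ e v t1, t1 != v, t1 \notin z1 :: C1 & t1 \notin z2 :: C2].
  by apply: RP; rewrite inE eqxx.
have [et2 t2v t2C1 t2C2] : [/\ e v t2, t2 != v, t2 \notin z1 :: C1 & t2 \notin z2 :: C2].
  by apply: RP; rewrite !inE eqxx orbT.
apply: (@spider_of_legs _ e q r v t1 t2 (z1 :: C1) (z2 :: C2)) => //; rewrite -?s1 -?s2 //.
have vL : v \notin (z1 :: C1) ++ z2 :: C2.
  by apply: contra vAB; rewrite !mem_cat => /orP[/sub1 ->|/sub2 ->]; rewrite ?orbT.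
have uL : uniq ((z1 :: C1) ++ z2 :: C2).
  rewrite cat_uniq u1 u2 andbT.
  by apply/hasPn => z /sub2 zB; apply/negP => /sub1 zA; apply: disAB zA zB.
have t1L : t1 \notin (z1 :: C1) ++ z2 :: C2 by rewrite mem_cat negb_or t1C1.
have t2L : t2 \notin (z1 :: C1) ++ z2 :: C2 by rewrite mem_cat negb_or t2C1.
move: vL uL t1L t2L; move: (_ ++ _) => L vL uL t1L t2L.
by rewrite /= !inE !negb_or vL t1L t2L t12 uL ![v == _]eq_sym t1v t2v.
Qed.

(** Leaving [v] along the cycle in both directions for [4 * m + 1] vertices each gives two disjoint
    paths, because the cycle has at least twice that many vertices besides [v]. *)
Lemma spider_of_long_cycle (T : finType) (e : rel T) (q r m : nat) (v : T) (s : seq T) :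
  symmetric e -> irreflexive e -> 0 < m -> q <= m -> r <= m ->
  path e v s -> e (last v s) v -> uniq (v :: s) ->
  8 * m + 2 <= size s -> 3 < degree e v ->
  contains_subgraph (@spider_edge 1 1 q r) e.
Proof.
move=> esym eirr m0 qm rm ps es us szs deg.
set h := 4 * m + 1.
have prs : path e v (rev s).
  have : cycle e (rev (v :: s)).
    rewrite rev_cycle (@eq_cycle _ _ e); last by move=> a b; rewrite /= esym.
    by rewrite /= rcons_path ps.
  by rewrite rev_cons -rot1_cons rot_cycle /= rcons_path => /andP[].
apply: (@spider_of_disjoint_paths _ e q r m v (take h s) (take h (rev s))) => //.
- exact: take_path.
- exact: take_path.
- rewrite take_rev; move: us; rewrite -{1}(cat_take_drop (size s - h) s).
  have -> : take h s = take h (take (size s - h) s) by rewrite take_takel // /h; lia.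
  rewrite !cons_uniq !mem_cat !negb_or mem_rev !cat_uniq rev_uniq.
  case/andP => /andP[v1 v2] /and3P[u1 h2 u2].
  rewrite v2 u2 take_uniq // !andbT has_rev; apply/andP; split.
    by apply: contra v1 => /mem_take.
  by apply: contra h2 => /hasP[z zd /mem_take zt]; apply/hasP; exists z.
- by rewrite size_takel /h; lia.
- by rewrite size_takel ?size_rev /h; lia.
Qed.

(** * Crossing edges in quasi-bridgeless graphs *)

(** By the degree conditions a bridge [x y] would be proper. So [x] and [y] stay connected once this
    edge is removed, and a remaining path between them has to leave [S]. *)
Lemma non_bridge_crossing (T : finType) (e : rel T) (x y : T) (S : pred T) :
  simple_graph e -> connected_graph e -> quasi_bridgeless e ->
  e x y -> degree e x != 1 -> degree e y != 1 -> S x -> ~~ S y ->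
  exists u w, [/\ S u, ~~ S w, e u w & ~~ ((u == x) && (w == y))].
Proof.
move=> [esym _] conn qb exy dx dy Sx Sy.
set f := remove_edge e x y.
have fsym : symmetric f.
  move=> a b; rewrite /f /remove_edge esym orbC.
  by rewrite [(b == x) && _]andbC [(b == y) && _]andbC.
have csym := sym_connect_sym fsym.
have cxy : connect f x y.
  apply/negPn/negP => ncxy; apply: (qb x y); split=> //; split=> //.
  have -> : ncomp e = 1.
    rewrite /ncomp -(n_comp_connect (sym_connect_sym esym) x).
    by apply: eq_n_comp_r => z; rewrite [RHS](conn x z).
  apply/card_gt1P; exists (root f x), (root f y).
  by split; rewrite ?inE ?roots_root //; rewrite (root_connect csym).
case/connectP: cxy => s pth lst.
have [u [w [Su Sw fuw]]] : exists u w, [/\ S u, ~~ S w & f u w].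
  rewrite {}lst in Sy; elim: s (x) pth Sx Sy => [|c s IHs] a /= pth Sa.
    by rewrite Sa.
  case/andP: pth => fac pth; case: (boolP (S c)) => [Sc|Sc _]; first exact: IHs.
  by exists a, c.
by exists u, w; move: fuw => /andP[-> ]; rewrite negb_or => /andP[].
Qed.

(* Boolean hypotheses that are not comparisons make [lia] explode, hence the clearing. *)
Ltac nat_lia :=
  repeat match goal with
    | H : is_true (leq _ _) |- _ => revert H
    | H : is_true (andb (leq _ _) (leq _ _)) |- _ => revert H
    | H : @eq nat _ _ |- _ => revert H
  end; clear; lia.

(** * Detours off a fixed path *)

Section LongPath.

Variables (T : finType) (e : rel T) (p : nat -> T) (L : nat).
Hypothesis p_inj : forall i j, i <= L -> j <= L -> p i = p j -> i = j.
Hypothesis p_edge : forall i, i < L -> e (p i) (p i.+1).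

Definition on_path : pred T := [pred x | x \in [seq p i | i <- iota 0 L.+1]].
(** Only the head has to be off the path: a walk of such steps may start on the path but never
    returns to it. *)
Definition off_step : rel T := [rel x y | e x y && ~~ on_path y].
(** A detour starting before [p y] ends with an edge from [reach y] to a path vertex. The set itself
    meets the path only in indices below [y]. *)
Definition reach (y : nat) : pred T :=
  [pred u | has (fun a => connect off_step (p a) u) (iota 0 y)].

Lemma on_pathP x : reflect (exists2 i, i <= L & x = p i) (on_path x).
Proof.
apply: (iffP mapP) => -[i]; first by rewrite mem_iota; exists i => //; nat_lia.
by move=> iL ->; exists i => //; rewrite mem_iota; nat_lia.
Qed.

Lemma reachP y u : reflect (exists2 a, a < y & connect off_step (p a) u) (reach y u).
Proof.
apply: (iffP hasP) => -[i]; first by rewrite mem_iota; exists i => //; nat_lia.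
by move=> iy ?; exists i => //; rewrite mem_iota; nat_lia.
Qed.

Lemma connect_off_path a u : connect off_step a u -> on_path u -> u = a.
Proof.
case/connectP => s; case: (lastP s) => [|s' z] //=.
by rewrite rcons_path last_rcons => /andP[_ /andP[_ /negbTE off]] ->; rewrite off.
Qed.

Lemma reach_on_path y i : y <= L.+1 -> i <= L -> reach y (p i) = (i < y).
Proof.
move=> yL iL; apply/reachP/idP => [[a ay c]|iy]; last by exists i.
suff -> : i = a by [].
apply: p_inj => //; first by nat_lia.
by apply: (connect_off_path c); apply/on_pathP; exists i.
Qed.

Lemma reach_connect y u w : reach y u -> connect off_step u w -> reach y w.
Proof.
by move=> /reachP[a ay c] c'; apply/reachP; exists a => //; apply: connect_trans c c'.
Qed.

Lemma reach_step y u w : reach y u -> e u w -> ~~ on_path w -> reach y w.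
Proof. by move=> ru euw off; apply: (reach_connect ru); apply: connect1; apply/andP. Qed.

Lemma sub_reach y y' : y <= y' -> subpred (reach y) (reach y').
Proof. by move=> yy u /reachP[a ay c]; apply/reachP; exists a => //; apply: leq_trans yy. Qed.

Lemma inner_degree i : simple_graph e -> 0 < i < L -> degree e (p i) != 1.
Proof.
move=> [esym _] /andP[i0 iL]; rewrite neq_ltn; apply/orP; right.
apply/card_gt1P; exists (p i.-1), (p i.+1); split.
- by rewrite inE esym -{2}(prednK i0) p_edge //; nat_lia.
- by rewrite inE p_edge.
apply/eqP => E; suff: i.-1 = i.+1 by nat_lia.
by apply: p_inj E; nat_lia.
Qed.

(* The vertex [p i] of degree at most 3 is not a cut vertex of the path: the
   edges before and after it are not bridges, and both detours have to use the
   third edge at [p i], so that they can be joined. *)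
Lemma reach_jump i :
  simple_graph e -> connected_graph e -> quasi_bridgeless e ->
  degree e (p 0) != 1 -> 0 < i -> i.+1 < L -> degree e (p i) <= 3 ->
  exists u b, [/\ reach i u, i < b <= L & e u (p b)].
Proof.
move=> sg conn qb d0 i0 iL deg; have [esym eirr] := sg.
have degn j : j < L -> degree e (p j) != 1.
  by case: j => // j jL; apply: inner_degree.
have target y u w : reach y u -> ~~ reach y w -> e u w -> y <= L ->
    exists2 b, y <= b <= L & w = p b.
  move=> ru rw euw yL; have : on_path w.
    by apply: contraNT rw; apply: reach_step euw.
  case/on_pathP => b bL wb; exists b => //; rewrite bL andbT leqNgt.
  by apply: contraNN rw; rewrite wb reach_on_path //; nat_lia.
(* First cut: the edge after [p i]. Its detour is as required unless it starts at [p i] itself. *)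
have [u [w [ru rw euw nuw]]] :
    exists u w, [/\ reach i.+1 u, ~~ reach i.+1 w, e u w & ~~ ((u == p i) && (w == p i.+1))].
  apply: non_bridge_crossing => //; rewrite ?p_edge ?degn ?reach_on_path //; nat_lia.
have [b /andP[ib bL] wb] : exists2 b, i.+1 <= b <= L & w = p b by apply: target rw euw _ => //; nat_lia.
case: (boolP (reach i u)) => [riu|nriu]; first by exists u, b; rewrite ib bL -wb.
(* Second cut: the edge before [p i]. Its detour is as required unless it ends at [p i]. *)
have [u' [w' [ru' rw' euw' nuw']]] :
    exists u w, [/\ reach i u, ~~ reach i w, e u w & ~~ ((u == p i.-1) && (w == p i))].
  apply: non_bridge_crossing => //; rewrite ?degn ?reach_on_path //; try nat_lia.
  by rewrite -{2}(prednK i0) p_edge //; nat_lia.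
have [b' /andP[ib' bL'] wb'] : exists2 b, i <= b <= L & w' = p b by apply: target rw' euw' _ => //; nat_lia.
have [{}ib'|Ei] : i < b' \/ b' = i by nat_lia.
  by exists u', b'; rewrite ib' bL' -wb'.
subst w' b'; rewrite eqxx andbT in nuw'.
have prv : reach i (p i.-1) by rewrite reach_on_path; nat_lia.
have nxt : ~~ reach i (p i.+1) by rewrite reach_on_path //; nat_lia.
(* [z] is the first vertex after [p i] on the first detour, possibly its end [w]. *)
have [z [eiz nz zn]] : exists z, [/\ e (p i) z, ~~ reach i z & z != p i.+1].
  case/reachP: ru => a ai cau.
  have Ea : a = i.
    apply/eqP; rewrite eqn_leq -ltnS ai leqNgt; apply: contraNN nriu => lai.
    by apply/reachP; exists a.
  rewrite {}Ea {ai a} in cau; case/connectP: cau => [[|z s] /=] pth lst.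
    exists w; rewrite {1}lst in nuw.
    rewrite lst in euw nuw; rewrite eqxx /= in nuw; split=> //.
    by rewrite wb reach_on_path //; nat_lia.
  case/andP: pth => /andP[eiz offz] pth; exists z; split=> //.
    apply: contra nriu => rz; rewrite lst; apply: reach_connect rz _.
    by apply/connectP; exists s.
  by apply: contraNneq offz => ->; apply/on_pathP; exists i.+1 => //; nat_lia.
(* If both exceptions occur, [p i.-1] and [u'] inside [reach i] and [p i.+1] and [z] outside it are
   four distinct neighbours of [p i]. *)
suff : 3 < degree e (p i) by rewrite ltnNge deg.
have un : uniq [:: p i.-1; u'; p i.+1; z].
  have ne x y : reach i x -> ~~ reach i y -> x != y by move=> rx; apply: contraNneq => <-.
  rewrite /= !inE !negb_or (eq_sym _ u') nuw' (eq_sym (p i.+1)) zn.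
  by rewrite !(ne (p i.-1)) ?(ne u').
rewrite -[X in X < _]/(size [:: p i.-1; u'; p i.+1]) /degree -[X in X <= _]/(size [:: p i.-1; u'; p i.+1; z]).
rewrite -(card_uniqP un); apply/subset_leq_card/subsetP => t; rewrite !inE.
case/or4P=> /eqP-> //.
- by rewrite esym -{2}(prednK i0) p_edge // prednK // ltnW // ltnW.
- by rewrite esym.
- exact: p_edge (ltnW iL).
Qed.

(** * Segments of the path *)

Lemma path_up a n : a + n <= L -> path e (p a) [seq p i | i <- iota a.+1 n].
Proof.
elim: n a => //= n IHn a anL; rewrite p_edge /=; first by apply: IHn; nat_lia.
by nat_lia.
Qed.

Lemma last_path_up a n : last (p a) [seq p i | i <- iota a.+1 n] = p (a + n).
Proof. by elim: n a => [|n IHn] a /=; rewrite ?addn0 // IHn addSnnS. Qed.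

Lemma path_down a n : symmetric e -> a + n <= L ->
  path e (p (a + n)) (rev [seq p i | i <- iota a n]).
Proof.
move=> esym anL.
have -> : [seq p i | i <- iota a n] = belast (p a) [seq p i | i <- iota a.+1 n].
  by elim: n a {anL} => //= n IHn a; rewrite IHn.
rewrite -last_path_up rev_path (@eq_path _ _ e) ?path_up // => x y.
Qed.

Lemma uniq_path_segment a n : a + n <= L.+1 -> uniq [seq p i | i <- iota a n].
Proof.
move=> anL; rewrite map_inj_in_uniq ?iota_uniq // => i j.
by rewrite !mem_iota => *; apply: p_inj => //; nat_lia.
Qed.

Lemma spider_of_inner_vertex q r m i :
  simple_graph e -> 0 < m -> q <= m -> r <= m ->
  4 * m < i -> i + 4 * m < L -> 3 < degree e (p i) ->
  contains_subgraph (@spider_edge 1 1 q r) e.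
Proof.
move=> [esym eirr] m0 qm rm mi iL deg.
apply: (@spider_of_disjoint_paths _ e q r m (p i)
  (rev [seq p j | j <- iota 0 i]) [seq p j | j <- iota i.+1 (L - i)]) => //.
- by have := @path_down 0 i esym; rewrite add0n; apply; nat_lia.
- by apply: path_up; nat_lia.
- have : uniq [seq p j | j <- iota 0 L.+1] by apply: uniq_path_segment.
  have -> : L.+1 = i + (L - i).+1 by nat_lia.
  rewrite iotaD map_cat /= add0n; apply: etrans; apply: (@perm_uniq _ (_ :: _)).
  by rewrite perm_sym perm_catC /= perm_cons perm_catC perm_cat2r perm_sym perm_rev.
- by rewrite size_rev size_map size_iota.
- by rewrite size_map size_iota; nat_lia.
Qed.

(** * Two disjoint paths woven from detours *)

(** Here [y] and [x] are consecutive terms of the sequence of farthest jumps, and [A], [B] are the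
    inner vertices of the two paths. Since [p y] and [p x] lie outside [reach y], confining [A] and
    [B] to it also separates them from the ends. *)
Record braid (y x : nat) (A B : seq T) : Prop := Braid {
  braid_lt : 0 < y < x;
  braid_le : x <= L;
  braid_pathA : path e (p 0) (rcons A (p x));
  braid_pathB : path e (p 0) (rcons B (p y));
  braid_uniq : uniq (p 0 :: A ++ B);
  braid_reach : all (reach y) (A ++ B);
  braid_max : forall u b, reach y u -> b <= L -> e u (p b) -> b <= x
}.

Lemma max_jump y u b : reach y u -> b <= L -> e u (p b) ->
  exists u' x, [/\ reach y u', b <= x <= L, e u' (p x)
    & forall u b, reach y u -> b <= L -> e u (p b) -> b <= x].
Proof.
move=> ru bL eub.
pose P b := (b <= L) && [exists u, reach y u && e u (p b)].
have exP : exists b, P b by exists b; rewrite /P bL; apply/existsP; exists u; rewrite ru.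
have ubP b' : P b' -> b' <= L by case/andP.
case: (ex_maxnP exP ubP) => x /andP[xL /existsP[u' /andP[ru' eux]]] max.
have jumpP u2 b2 : reach y u2 -> b2 <= L -> e u2 (p b2) -> b2 <= x.
  by move=> ru2 b2L eub2; apply: max; rewrite /P b2L; apply/existsP; exists u2; rewrite ru2.
by exists u', x; split=> //; rewrite xL andbT; apply: jumpP ru bL eub.
Qed.

Lemma off_path_connection a u : connect off_step a u ->
  exists s, [/\ path e a s, last a s = u, uniq (a :: s), ~~ has on_path s
    & forall z, z \in s -> connect off_step a z /\ connect off_step z u].
Proof.
case/connectP => s0 /shortenP[s pth un _ ->] {s0}; exists s; split=> //.
- by apply: sub_path pth => x y /andP[].
- apply/hasPn => z; elim: s a pth {un} => //= c s IHs a /andP[/andP[_ offc] pth].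
  by rewrite inE => /orP[/eqP->//|]; apply: IHs pth.
move=> z zs; split; first by apply: (path_connect pth); rewrite inE zs orbT.
case/splitPr: zs pth => s1 s2; rewrite cat_path last_cat /= => /and3P[_ _ pth].
by apply/connectP; exists s2.
Qed.

(** One branch is the edge from [p 0] to [p 1], with no inner vertex; the other is a farthest detour
    from [p 0], the only possible start before index 1. *)
Lemma braid_init u b :
  0 < L -> irreflexive e -> reach 1 u -> 1 < b <= L -> e u (p b) -> exists x A, braid 1 x A [::].
Proof.
move=> L0 eirr ru /andP[b1 bL] eub.
have [u' [x [ru' /andP[bx xL] eux xmax]]] := max_jump ru bL eub.
case/reachP: ru' => -[|//] _ /off_path_connection[A [pA lA uA offA cA]].
exists x, A; split=> //.
- by nat_lia.
- by rewrite rcons_path pA lA.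
- by rewrite /= p_edge.
- by rewrite cats0.
- rewrite cats0; apply/allP => z /cA[cz _]; apply/reachP; by exists 0.
Qed.

(* The new detour avoids [reach y], where both old branches live: otherwise
   its end would already be within reach of the previous maximal jump. *)
Lemma braid_step y x A B u b :
  braid y x A B -> reach x u -> x < b <= L -> e u (p b) ->
  exists x' S, braid x x' (B ++ p y :: S) A.
Proof.
move=> [/andP[y0 yx] xL pA pB un rch ymax] ru /andP[xb bL] eub.
have [u' [x' [ru' /andP[bx' xL'] eux xmax]]] := max_jump ru bL eub.
(* The new jump passes [x], the farthest index attainable from [reach y]; hence its start [a] is at
   least [y]. *)
have nru' : ~~ reach y u' by apply/negP => ryu; have := ymax _ _ ryu xL' eux; nat_lia.
case/reachP: ru' => a ax cau.
have ya : y <= a by rewrite leqNgt; apply: contra nru' => ay; apply/reachP; exists a.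
have [s [ps ls us offs cs]] := off_path_connection cau.
(* The branch ending at [p y] continues along the path to [p a] and then by the detour to [p x']. As
   [a < x], it stops short of [p x], where the other branch ends, and the branches swap roles. *)
pose U := [seq p i | i <- iota y.+1 (a - y)].
have lU : last (p y) U = p a by rewrite last_path_up subnKC.
have UP z : z \in U -> exists2 i, y < i <= a & z = p i.
  by case/mapP => i; rewrite mem_iota => ii ->; exists i => //; nat_lia.
have onU z : z \in p y :: U -> on_path z.
  rewrite inE => /orP[/eqP->|/UP[i ii ->]]; apply/on_pathP; [exists y|exists i] => //; nat_lia.
have rU z : z \in p y :: U ++ s -> reach x z.
  rewrite inE mem_cat => /or3P[/eqP->|/UP[i ii ->]|/cs[cz _]].
  - by rewrite reach_on_path; nat_lia.
  - by rewrite reach_on_path; nat_lia.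
  - by apply/reachP; exists a.
have nrU z : z \in p y :: U ++ s -> ~~ reach y z.
  rewrite inE mem_cat => /or3P[/eqP->|/UP[i ii ->]|/cs[_ cz]].
  - by rewrite reach_on_path; nat_lia.
  - by rewrite reach_on_path; nat_lia.
  - by apply: contra nru' => rz; apply: reach_connect rz cz.
have uU : uniq (p y :: U ++ s).
  have -> : p y :: U ++ s = [seq p i | i <- iota y (a - y).+1] ++ s by [].
  rewrite cat_uniq uniq_path_segment /=; last by nat_lia.
  move: us => /= /andP[_ ->]; rewrite andbT; apply: contra offs => /hasP[z zs zU].
  by apply/hasP; exists z => //; apply: onU.
have sub := sub_reach (ltnW yx).
have r0 : reach y (p 0) by rewrite reach_on_path; nat_lia.
exists x', (U ++ s); split=> //.
- by nat_lia.
- rewrite rcons_path cat_path /= last_cat /= last_cat lU ls eux andbT.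
  move: pB; rewrite rcons_path => /andP[-> ->] /=.
  by rewrite cat_path lU ps andbT; apply: path_up; nat_lia.
- have pe : perm_eq (p 0 :: (B ++ p y :: U ++ s) ++ A) ((p 0 :: A ++ B) ++ p y :: U ++ s).
    by rewrite /= perm_cons perm_sym -catA -[X in perm_eq _ X]catA perm_catC -catA.
  rewrite (perm_uniq pe) cat_uniq un uU andbT; apply/hasPn => z /nrU nrz /=.
  apply: contra nrz; rewrite inE => /orP[/eqP-> //|].
  by move/(allP rch).
- apply/allP => z; rewrite mem_cat (mem_cat _ B) => /orP[/orP[zB|/rU //]|zA].
    by apply/sub/(allP rch); rewrite mem_cat zB orbT.
  by apply/sub/(allP rch); rewrite mem_cat zA.
Qed.

(** Go through [A] to [p x], down the path to [p y], and back through [B]. The descending segment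
    lies outside [reach y] and so avoids both branches. *)
Lemma braid_cycle y x A B : symmetric e -> braid y x A B ->
  exists s, [/\ path e (p 0) s, e (last (p 0) s) (p 0), uniq (p 0 :: s)
    & size A + size B + (x - y) <= size s].
Proof.
move=> esym [/andP[y0 yx] xL pA pB un rch _].
pose D := rev [seq p i | i <- iota y (x - y)].
have pD : path e (p x) D.
  by rewrite -{1}(subnKC (ltnW yx)); apply: path_down; rewrite // subnKC // ltnW.
have lD : last (p x) D = p y.
  rewrite /D; have -> : x - y = (x - y).-1.+1 by nat_lia.
  by rewrite /= rev_cons last_rcons.
have pB' : path e (p y) (rcons (rev B) (p 0)).
  have -> : rcons (rev B) (p 0) = rev (belast (p 0) (rcons B (p y))).
    by rewrite belast_rcons rev_cons.
  rewrite -[X in path _ X _](last_rcons (p 0) B) rev_path.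
  by rewrite (@eq_path _ _ e) // => a b; rewrite /= esym.
move: pA pB'; rewrite !rcons_path => /andP[pA eA] /andP[pB' eB].
exists (A ++ p x :: D ++ rev B); split.
- by rewrite cat_path pA /= eA cat_path pD lD.
- by rewrite last_cat /= last_cat lD.
- have pe : perm_eq (p 0 :: A ++ p x :: D ++ rev B)
      ((p 0 :: A ++ B) ++ [seq p i | i <- iota y (x - y).+1]).
    rewrite cat_cons perm_cons -catA perm_cat2l perm_sym perm_catC.
    rewrite -addn1 iotaD map_cat /= (subnKC (ltnW yx)) -catA /=.
    rewrite perm_catC /= perm_cons perm_catC.
    by apply: perm_cat; rewrite perm_sym perm_rev.
  rewrite (perm_uniq pe) cat_uniq un uniq_path_segment ?andbT; last by nat_lia.
  apply/hasPn => z /mapP[i]; rewrite mem_iota => ii -> /=.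
  have : ~~ reach y (p i) by rewrite reach_on_path; nat_lia.
  apply: contra; rewrite inE => /orP[/eqP->|/(allP rch) //].
  by rewrite reach_on_path; nat_lia.
- by rewrite size_cat /= size_cat !size_rev size_map size_iota; nat_lia.
Qed.

Lemma long_cycle_of_jumps N M :
  simple_graph e -> N * N.+1 + 1 <= M -> 0 < L ->
  (forall i, 0 < i <= M -> exists u b, [/\ reach i u, i < b <= L & e u (p b)]) ->
  exists s, [/\ path e (p 0) s, e (last (p 0) s) (p 0), uniq (p 0 :: s) & N <= size s].
Proof.
move=> [esym eirr] MN L0 jump.
suff [y [x [A [B [br long]]]]] :
    exists y x A B, braid y x A B /\ N <= size A + size B + (x - y).
  have [s [ps es us szs]] := braid_cycle esym br.
  by exists s; split=> //; apply: leq_trans long szs.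
(* Each step adds at least the vertex [p y] to the branches, and without a jump of length [N] the
   index [x] grows by less than [N]. The bound on [x] keeps it in the range where [jump] applies. *)
have grow k : k <= N -> exists y x A B, braid y x A B /\
    (N <= x - y \/ k <= size A + size B /\ x <= k.+1 * N + 1).
  elim: k => [_|k IHk kN].
    have [|u [b [ru ub eub]]] := jump 1; first by nat_lia.
    have [x [A br]] := braid_init L0 eirr ru ub eub.
    by exists 1, x, A, [::]; split=> //; nat_lia.
  have [y [x [A [B [br]]]]] := IHk (ltnW kN).
  case=> [big|[szk xk]]; first by exists y, x, A, B; split=> //; left.
  have kM : k.+1 * N + 1 <= M.
    by apply: leq_trans MN; rewrite leq_add2r mulnC leq_mul2l; nat_lia.
  have [|u [b [ru ub eub]]] := jump x; first by have := braid_lt br; nat_lia.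
  have [x' [S br']] := braid_step br ru ub eub.
  exists x, x', (B ++ p y :: S), A; split=> //.
  case: (leqP N (x' - x)) => [|lt]; [by left|right].
  by rewrite size_cat /= [k.+2 * N]mulSn; split; nat_lia.
have [y [x [A [B [br H]]]]] := grow N (leqnn N).
by exists y, x, A, B; split=> //; case: H => [|[]]; nat_lia.
Qed.

End LongPath.

(** * Long paths force the spider, and the treedepth bound *)

Lemma spider_of_long_path (T : finType) (e : rel T) (q r m : nat) (v : T) (s : seq T) :
  let N := 8 * m + 2 in
  simple_graph e -> connected_graph e -> quasi_bridgeless e ->
  0 < m -> q <= m -> r <= m ->
  3 < degree e v -> path e v s -> uniq (v :: s) ->
  N * N.+1 + 1 + N <= size s ->
  contains_subgraph (@spider_edge 1 1 q r) e.
Proof.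
move=> N sg conn qb m0 qm rm deg ps us szs.
pose p i := nth v (v :: s) i.
have p_inj i j : i <= size s -> j <= size s -> p i = p j -> i = j.
  by move=> iL jL /eqP; rewrite nth_uniq // => /eqP.
have p_edge i : i < size s -> e (p i) (p i.+1) by move=> iL; apply: (pathP v ps).
(* Take the last vertex of degree at least 4 that still has more than [4 * m] path edges after it.
   Either it lies deep enough in the path to be a center, or the path is restarted there. *)
pose P i := (i + 4 * m < size s) && (3 < degree e (p i)).
have exP : exists i, P i by exists 0; rewrite /P deg andbT; nat_lia.
have ubP i : P i -> i <= size s by case/andP; nat_lia.
case: (ex_maxnP exP ubP) => i /andP[im degi] imax.
have [mi|im4] := ltnP (4 * m) i.
  exact: (spider_of_inner_vertex p_inj p_edge sg m0 qm rm mi im degi).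
pose p' j := p (i + j).
have p'_inj j k : j <= size s - i -> k <= size s - i -> p' j = p' k -> j = k.
  move=> jL kL E; apply/eqP; rewrite -(eqn_add2l i); apply/eqP.
  by apply: p_inj E; nat_lia.
have p'_edge j : j < size s - i -> e (p' j) (p' j.+1).
  by move=> jL; rewrite /p' addnS; apply: p_edge; nat_lia.
have degi' : 3 < degree e (p' 0) by rewrite /p' addn0.
have [|||c [pc ec uc szc]] :=
    @long_cycle_of_jumps T e p' (size s - i) p'_inj p'_edge N (N * N.+1 + 1) sg.
- by [].
- by nat_lia.
- move=> j /andP[j0 jM]; apply: (reach_jump p'_inj p'_edge sg conn qb) => //.
  + by apply: contraTneq degi' => ->.
  + by nat_lia.
  + rewrite leqNgt; apply/negP => degj.
    suff : i + j <= i by nat_lia.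
    (* As [i <= 4 * m], the summand [N] in the length leaves enough room after [p (i + j)] for the
       maximality of [i] to apply. *)
    by apply: imax; rewrite /P degj andbT; nat_lia.
by case: sg => esym eirr; apply: (spider_of_long_cycle esym eirr m0 qm rm pc ec uc szc degi').
Qed.

Theorem theorem12 (q r : nat) (hq : 0 < q) (hr : 0 < r) :
  exists c : nat,
    forall (T : finType) (e : rel T),
      simple_graph e ->
      connected_graph e ->
      quasi_bridgeless e ->
      subgraph_free (@spider_edge 1 1 q r) e ->
      ~ subcubic e ->
      treedepth_le e c.
Proof.
pose m := maxn q r; pose N := 8 * m + 2.
(* The path length from which the spider is forced; all paths from [v] are shorter than this. *)
exists (N * N.+1 + 1 + N) => T e sg conn qb free nsub.
have [v deg] : exists v, 3 < degree e v.
  case: (boolP [exists v, 3 < degree e v]) => [/existsP //|/existsPn small].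
  by case: nsub => v; rewrite leqNgt small.
apply: (treedepth_le_of_short_paths (v := v)) => // [|s ps us]; first by case: sg.
rewrite ltnNge; apply/negP => long; apply: free.
by apply: (spider_of_long_path (m := m) sg conn qb _ _ _ deg ps us long); rewrite /m; nat_lia.
Qed.
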